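(* Let $\alpha>0$. Then for each $\delta>0$ there exists a constant $C_\delta>0$ such that $$\int_T^{T+\delta}|\zeta(1+it,\alpha)|\,dt\ge C_\delta>0$$ for all $T\ge 2$.
   Context: $\zeta(s,\alpha)$ is the Hurwitz zeta-function, i.e. the analytic continuation of $\sum_{n=0}^\infty(n+\alpha)^{-s}$, $\operatorname{Re}(s)>1$. The constant $C_\delta$ does not depend on $T$ (it may depend on $\delta$ and $\alpha$). *)

(* Defs.v *)
From Stdlib Require Import Reals.
From Coquelicot Require Import Coquelicot.

Local Open Scope R_scope.

Definition Cexp (z : C) : C :=
  (exp (fst z) * cos (snd z), exp (fst z) * sin (snd z)).

(** Only meaningful for a real base [x > 0]. *)
Definition RCpow (x : R) (s : C) : C := Cexp (s * ln x)%C.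

Definition hurwitz_term (alpha : R) (s : C) (n : nat) : C :=
  RCpow (INR n + alpha) (- s)%C.

(** [Z] is the Hurwitz zeta-function [zeta(. , alpha)] away from its pole: the
    analytic continuation to the connected domain [C \ {1}] of the Dirichlet
    series, hence unique there.  The value [Z 1] is unconstrained. *)
Definition is_hurwitz_zeta (alpha : R) (Z : C -> C) : Prop :=
  (forall s : C, s <> 1%C -> ex_derive (K := C_AbsRing) (V := C_NormedModule) Z s) /\
  (forall s : C, 1 < Re s ->
     is_series (K := C_AbsRing) (V := C_NormedModule) (hurwitz_term alpha s) (Z s)).

(* Main.v *)
Require Import Defs.
From Stdlib Require Import Reals Lra Lia.
From Coquelicot Require Import Coquelicot.
Local Open Scope R_scope.

(** With [h] the length of the interval, [r = 2 PI / h] and [t] in [[0, h]], integrate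
    [zeta (sigma + i (T + t))] against the bounded kernel
    [(1 - e^(-i r t))^J alpha^(i t)]. The [n]-th term of the Dirichlet series gets
    multiplied by [I_J (x_n)], where [x_n = ln (1 + n / alpha)] and
    [I_J x = int_0^h (1 - e^(-i r t))^J e^(-i x t) dt
           = - i (1 - e^(-i x h)) J! r^J / (x (x + r) ... (x + J r))].
    Since [I_J 0 = h] while, for [x >= x_1], [I_J x] is [O (x^(-2))] times the product
    of the [1 / (1 + x_1 / (j r))] for [2 <= j <= J], which tends to 0 by divergence of
    the harmonic series, and since [sum 1 / ((n + alpha) x_n^2)] converges, for large
    [J] the term [n = 0] dominates all the others together. This holds uniformly in [T]
    and in [sigma > 1], and [sigma] tends to 1 by continuity of [zeta]. *)

(** * Unimodular exponentials and integrals of complex-valued functions *)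

Definition cis (x : R) : C := (cos x, sin x).

Lemma cis_0 : cis 0 = 1%C.
Proof. unfold cis; now rewrite cos_0, sin_0. Qed.

Lemma cis_add (x y : R) : cis (x + y) = (cis x * cis y)%C.
Proof.
  unfold cis; rewrite cos_plus, sin_plus.
  apply injective_projections; simpl; ring.
Qed.

Lemma Cmod_cis (x : R) : Cmod (cis x) = 1.
Proof.
  unfold Cmod, cis; simpl.
  replace (_ + _) with (Rsqr (sin x) + Rsqr (cos x)) by (unfold Rsqr; ring).
  rewrite sin2_cos2; apply sqrt_1.
Qed.

(** Lets [norm_RInt_le], which speaks of the norm of [C] as a real module, be used with [Cmod]. *)
Lemma norm_C_R (z : C) : norm (V := C_R_NormedModule) z = Cmod z.
Proof.
  unfold Cmod; destruct z as [x y]; simpl.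
  unfold norm; simpl; unfold prod_norm, norm; simpl; unfold abs; simpl.
  f_equal; rewrite !Rmult_1_r; f_equal; symmetry; apply (Rsqr_abs _).
Qed.

(** [is_RInt_scal] over [C_R_NormedModule] takes real factors only, so a complex one is handled on
    real and imaginary parts. *)
Lemma is_RInt_Cmult (f : R -> C) (a b : R) (c l : C) :
  is_RInt (V := C_R_NormedModule) f a b l ->
  is_RInt (V := C_R_NormedModule) (fun t => c * f t)%C a b (c * l)%C.
Proof.
  intros H.
  assert (H1 := is_RInt_fct_extend_fst _ _ _ _ H).
  assert (H2 := is_RInt_fct_extend_snd _ _ _ _ H).
  apply (is_RInt_fct_extend_pair (U := R_NormedModule) (V := R_NormedModule)); simpl.
  - exact (is_RInt_minus _ _ _ _ _ _ (is_RInt_scal _ _ _ (fst c) _ H1)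
             (is_RInt_scal _ _ _ (snd c) _ H2)).
  - exact (is_RInt_plus _ _ _ _ _ _ (is_RInt_scal _ _ _ (fst c) _ H2)
             (is_RInt_scal _ _ _ (snd c) _ H1)).
Qed.

Lemma is_RInt_cis (h x : R) : x <> 0 ->
  is_RInt (V := C_R_NormedModule) (fun t => cis (- (x * t))) 0 h
    (- Ci * (1 - cis (- (x * h))) * (/ x)%R)%C.
Proof.
  intros Hx.
  (* The two components are the increments over [[0, h]] of the antiderivatives [sin (x t) / x] and
     [cos (x t) / x]. *)
  assert (E : (- Ci * (1 - cis (- (x * h))) * (/ x)%R)%C
     = (sin (x * h) / x - sin (x * 0) / x, cos (x * h) / x - cos (x * 0) / x)).
  { rewrite Rmult_0_r, sin_0, cos_0.
    unfold cis; rewrite cos_neg, sin_neg.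
    apply injective_projections; simpl; field; assumption. }
  rewrite E.
  apply (is_RInt_fct_extend_pair (U := R_NormedModule) (V := R_NormedModule)); simpl.
  - apply (is_RInt_derive (fun t => sin (x * t) / x)).
    + intros t _; auto_derive; trivial; rewrite cos_neg; field; assumption.
    + intros t _; apply (ex_derive_continuous (V := R_NormedModule)); auto_derive; trivial.
  - apply (is_RInt_derive (fun t => cos (x * t) / x)).
    + intros t _; auto_derive; trivial; rewrite sin_neg; field; assumption.
    + intros t _; apply (ex_derive_continuous (V := R_NormedModule)); auto_derive; trivial.
Qed.

(** * The kernel: its integrals against exponentials, and their decay *)

Definition kernel (r : R) (J : nat) (t : R) : C := ((1 - cis (- (r * t))) ^ J)%C.

Lemma Cmod_kernel_le (r : R) (J : nat) (t : R) : Cmod (kernel r J t) <= 2 ^ J.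
Proof.
  unfold kernel; rewrite Cmod_pow.
  apply pow_incr; split; [apply Cmod_ge_0|].
  eapply Rle_trans; [apply Cmod_triangle|].
  rewrite Cmod_opp, Cmod_cis, Cmod_1; lra.
Qed.

(** Closed form: [J! r^J / (x (x + r) ... (x + J r))]. *)
Fixpoint beta_prod (r : R) (J : nat) (x : R) : R :=
  match J with
  | O => / x
  | S J' => beta_prod r J' x * (INR J * r / (x + INR J * r))
  end.

(** Shifting by [r] moves each denominator factor onto the next: [x] drops out and [x + (J + 1) r]
    comes in. *)
Lemma beta_prod_shift (r x : R) (J : nat) : 0 < r -> 0 < x ->
  beta_prod r J (x + r) = beta_prod r J x * (x / (x + INR (S J) * r)).
Proof.
  intros Hr Hx; induction J as [|J IH].
  - simpl; field; lra.
  - change (beta_prod r (S J) (x + r)) with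
      (beta_prod r J (x + r) * (INR (S J) * r / (x + r + INR (S J) * r))).
    change (beta_prod r (S J) x) with
      (beta_prod r J x * (INR (S J) * r / (x + INR (S J) * r))).
    rewrite IH, (S_INR (S J)).
    assert (0 <= INR (S J) * r) by (apply Rmult_le_pos; [apply pos_INR|lra]).
    field; lra.
Qed.

(** By the shift formula, the difference carries the factor [1 - x / (x + (J + 1) r)], which is the
    new factor of [beta_prod r (S J) x]. It mirrors [kernel_S_cis]. *)
Lemma beta_prod_diff (r x : R) (J : nat) : 0 < r -> 0 < x ->
  beta_prod r J x - beta_prod r J (x + r) = beta_prod r (S J) x.
Proof.
  intros Hr Hx; rewrite beta_prod_shift by assumption.
  change (beta_prod r (S J) x) with
      (beta_prod r J x * (INR (S J) * r / (x + INR (S J) * r))).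
  assert (0 <= INR (S J) * r) by (apply Rmult_le_pos; [apply pos_INR|lra]).
  field; lra.
Qed.

Lemma kernel_S_cis (r x t : R) (J : nat) :
  (kernel r (S J) t * cis (- (x * t)))%C
  = (kernel r J t * cis (- (x * t)) - kernel r J t * cis (- ((x + r) * t)))%C.
Proof.
  unfold kernel; rewrite Cpow_S.
  replace (- ((x + r) * t)) with (- (x * t) + - (r * t)) by ring.
  rewrite cis_add; ring.
Qed.

(** Induction on [J] for all [x] at once: one more kernel factor takes the difference between
    frequencies [x] and [x + r], and [beta_prod] obeys the same recurrence. *)
Lemma is_RInt_kernel_cis (h r x : R) (J : nat) :
  0 < r -> r * h = 2 * PI -> 0 < x ->
  is_RInt (V := C_R_NormedModule) (fun t => kernel r J t * cis (- (x * t)))%C 0 h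
    (- Ci * (1 - cis (- (x * h))) * beta_prod r J x)%C.
Proof.
  intros Hr Hh; revert x; induction J as [|J IH]; intros x Hx.
  - eapply is_RInt_ext; [|apply is_RInt_cis; lra].
    intros t _; unfold kernel; simpl; ring.
  (* Since [r h = 2 PI], the boundary factor is the same at [x] and [x + r], so only the [beta_prod]
     values are subtracted. *)
  - assert (E : cis (- ((x + r) * h)) = cis (- (x * h))).
    { replace (- ((x + r) * h)) with (- (x * h) + - (2 * PI)) by (rewrite <- Hh; ring).
      rewrite cis_add.
      replace (cis (- (2 * PI))) with (1 : C); [ring|].
      unfold cis; now rewrite cos_neg, sin_neg, cos_2PI, sin_2PI, Ropp_0. }
    assert (H := is_RInt_minus _ _ _ _ _ _ (IH x Hx) (IH (x + r) ltac:(lra))).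
    rewrite E in H.
    rewrite <- beta_prod_diff by assumption.
    rewrite RtoC_minus.
    replace (_ * (_ - _))%C with
     (- Ci * (1 - cis (- (x * h))) * beta_prod r J x -
      - Ci * (1 - cis (- (x * h))) * beta_prod r J (x + r))%C by ring.
    eapply is_RInt_ext; [|exact H].
    intros t _; rewrite kernel_S_cis; reflexivity.
Qed.

(** Frequency 0, where the closed form is singular. Each new kernel factor subtracts the integral at
    frequency [r], which vanishes over a full period; the value stays that of [J = 0]. *)
Lemma is_RInt_kernel (h r : R) (J : nat) :
  0 < r -> r * h = 2 * PI ->
  is_RInt (V := C_R_NormedModule) (kernel r J) 0 h (RtoC h).
Proof.
  intros Hr Hh; induction J as [|J IH].
  - assert (H := is_RInt_const (V := C_R_NormedModule) 0 h (RtoC 1)).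
    replace (h : C) with (scal (V := C_R_NormedModule) (h - 0) (RtoC 1)); [exact H|].
    apply injective_projections; cbn; unfold scal, mult; simpl; unfold mult; simpl; ring.
  - assert (H := is_RInt_minus _ _ _ _ _ _ IH (is_RInt_kernel_cis h r r J Hr Hh Hr)).
    assert (E : cis (- (r * h)) = 1%C).
    { rewrite Hh; unfold cis; now rewrite cos_neg, sin_neg, cos_2PI, sin_2PI, Ropp_0. }
    rewrite E in H.
    replace (h : C) with (h - - Ci * (1 - 1) * beta_prod r J r)%C by ring.
    eapply is_RInt_ext; [|exact H].
    intros t _. change ((kernel r J t - kernel r J t * cis (- (r * t)))%C = kernel r (S J) t).
    unfold kernel; rewrite Cpow_S; ring.
Qed.

(** The product of the [1 / (1 + a / j)] for [2 <= j <= J + 1]: the factor [j = 1] of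
    [beta_prod] is kept aside, for the decay in [x]. *)
Fixpoint gap_prod (a : R) (J : nat) : R :=
  match J with
  | O => 1
  | S J' => gap_prod a J' / (1 + a / INR (S J))
  end.

Lemma gap_prod_pos (a : R) (J : nat) : 0 < a -> 0 < gap_prod a J.
Proof.
  intros Ha; induction J as [|J IH]; [simpl; lra|].
  change (0 < gap_prod a J / (1 + a / INR (S (S J)))).
  apply Rdiv_lt_0_compat; [assumption|].
  assert (0 < a / INR (S (S J))) by (apply Rdiv_lt_0_compat; [lra|apply lt_0_INR; lia]).
  lra.
Qed.

Lemma ln_succ_sub_le (y : R) : 0 < y -> ln (y + 1) - ln y <= / y.
Proof.
  intros Hy; rewrite <- ln_div by lra.
  replace ((y + 1) / y) with (1 + / y) by (field; lra).
  assert (0 < / y) by now apply Rinv_0_lt_compat.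
  rewrite <- (ln_exp (/ y)) at 2.
  apply ln_le; [lra|apply exp_ineq1_le].
Qed.

(** The inverse product is at least [1 + a] times the sum of [1 / j] for [2 <= j <= J + 1], and the
    logarithms bound that harmonic sum from below. *)
Lemma gap_prod_le (a : R) (J : nat) : 0 < a ->
  gap_prod a J * (1 + a * (ln (INR J + 2) - ln 2)) <= 1.
Proof.
  intros Ha; induction J as [|J IH].
  - simpl; rewrite Rplus_0_l; lra.
  - change (gap_prod a (S J)) with (gap_prod a J / (1 + a / INR (S (S J)))).
    assert (Hg := gap_prod_pos a J Ha).
    assert (HJ : INR (S (S J)) = INR J + 2) by (rewrite !S_INR; ring).
    rewrite HJ, S_INR.
    assert (H0 := pos_INR J).
    assert (Hl := ln_succ_sub_le (INR J + 2) ltac:(lra)).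
    replace (INR J + 2 + 1) with (INR J + 1 + 2) in Hl by ring.
    assert (Hm : ln 2 <= ln (INR J + 2)) by (apply ln_le; lra).
    set (A := ln (INR J + 2)) in *; set (B := ln (INR J + 1 + 2)) in *.
    assert (Hd : 0 < a / (INR J + 2)) by (apply Rdiv_lt_0_compat; lra).
    assert (Hs : a * (B - A) <= a / (INR J + 2)) by (apply Rmult_le_compat_l; lra).
    set (d := a / (INR J + 2)) in *.
    apply (Rmult_le_reg_r (1 + d)); [lra|].
    replace (gap_prod a J / (1 + d) * (1 + a * (B - ln 2)) * (1 + d))
      with (gap_prod a J * (1 + a * (B - ln 2))) by (field; lra).
    assert (0 <= a * (A - ln 2)) by (apply Rmult_le_pos; lra).
    assert (gap_prod a J <= 1) by nra.
    assert (gap_prod a J * (a * (B - A)) <= 1 * d).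
    { apply Rle_trans with (gap_prod a J * d); [|apply Rmult_le_compat_r]; try lra.
      apply Rmult_le_compat_l; lra. }
    nra.
Qed.

Lemma gap_prod_small (a e : R) : 0 < a -> 0 < e -> exists J, gap_prod a J <= e.
Proof.
  intros Ha He.
  (* The threshold is where [a * (ln y - ln 2)] reaches [1 / e]. *)
  destruct (INR_unbounded (exp (/ (a * e) + ln 2))) as [J HJ].
  exists J.
  assert (H := gap_prod_le a J Ha).
  assert (Hg := gap_prod_pos a J Ha).
  assert (Hl : / (a * e) + ln 2 <= ln (INR J + 2)).
  { rewrite <- (ln_exp (_ + _)); apply ln_le; [apply exp_pos|lra]. }
  assert (Hae : 0 < a * e) by (apply Rmult_lt_0_compat; assumption).
  assert (/ e <= a * (ln (INR J + 2) - ln 2)).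
  { replace (/ e) with (a * / (a * e)) by (field; lra).
    apply Rmult_le_compat_l; lra. }
  assert (gap_prod a J * / e <= 1) by nra.
  apply (Rmult_le_reg_r (/ e)); [now apply Rinv_0_lt_compat|].
  rewrite Rinv_r; lra.
Qed.

(** The factors [j = 0] and [j = 1] give [r / (x (x + r)) <= r / x^2]. Each later one,
    [j r / (x + j r)], decreases in [x], so it is largest at [x = c], where it is a factor of
    [gap_prod (c / r)]. *)
Lemma beta_prod_le (r c x : R) (J : nat) : 0 < r -> 0 < c -> c <= x ->
  0 <= beta_prod r (S J) x <= r * gap_prod (c / r) J / x ^ 2.
Proof.
  intros Hr Hc Hx; induction J as [|J [IH0 IH]].
  - simpl; split.
    + assert (0 < / x) by (apply Rinv_0_lt_compat; lra).
      assert (0 < / (x + 1 * r)) by (apply Rinv_0_lt_compat; lra).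
      unfold Rdiv; apply Rmult_le_pos; [lra|apply Rmult_le_pos; lra].
    + replace (r * 1 / (x * (x * 1))) with (/ x * (r * / x)) by (field; lra).
      assert (0 < / x) by (apply Rinv_0_lt_compat; lra).
      rewrite Rmult_1_l.
      apply Rmult_le_compat_l; [lra|apply Rmult_le_compat_l; [lra|]].
      apply Rinv_le_contravar; lra.
  - change (beta_prod r (S (S J)) x) with
      (beta_prod r (S J) x * (INR (S (S J)) * r / (x + INR (S (S J)) * r))).
    change (gap_prod (c / r) (S J)) with (gap_prod (c / r) J / (1 + c / r / INR (S (S J)))).
    assert (Hn : 0 < INR (S (S J))) by (apply lt_0_INR; lia).
    set (n := INR (S (S J))) in *.
    assert (0 < n * r) by (apply Rmult_lt_0_compat; lra).
    assert (Hf : 0 <= n * r / (x + n * r)).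
    { apply Rlt_le, Rdiv_lt_0_compat; lra. }
    assert (Hf' : n * r / (x + n * r) <= / (1 + c / r / n)).
    { replace (/ (1 + c / r / n)) with (n * r / (c + n * r)) by (field; lra).
      apply Rmult_le_compat_l; [lra|apply Rinv_le_contravar; lra]. }
    split; [now apply Rmult_le_pos|].
    replace (r * (gap_prod (c / r) J / (1 + c / r / n)) / x ^ 2) with
      (r * gap_prod (c / r) J / x ^ 2 * / (1 + c / r / n))
      by (unfold Rdiv; ring).
    now apply Rmult_le_compat.
Qed.

(** * The frequencies [ln (1 + n / alpha)] and the convergent sum of weights *)

Lemma ln_succ_sub_ge (y : R) : 0 < y -> / (y + 1) <= ln (y + 1) - ln y.
Proof.
  intros Hy.
  assert (H : ln (y / (y + 1)) <= - / (y + 1)).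
  { rewrite <- (ln_exp (- / (y + 1))).
    apply ln_le; [apply Rdiv_lt_0_compat; lra|].
    replace (y / (y + 1)) with (1 + - / (y + 1)) by (field; lra).
    apply exp_ineq1_le. }
  rewrite ln_div in H; lra.
Qed.

Definition lgap (alpha : R) (n : nat) : R := ln (INR n + alpha) - ln alpha.

Lemma exp_opp_lgap (alpha : R) (n : nat) : 0 < alpha ->
  exp (- lgap alpha n) = alpha / (INR n + alpha).
Proof.
  intros Ha; unfold lgap.
  assert (H0 := pos_INR n).
  replace (- _) with (ln alpha - ln (INR n + alpha)) by ring.
  rewrite <- ln_div by lra.
  apply exp_ln, Rdiv_lt_0_compat; lra.
Qed.

Lemma lgap_1_pos (alpha : R) : 0 < alpha -> 0 < lgap alpha 1.
Proof.
  intros Ha; unfold lgap; simpl INR.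
  assert (ln alpha < ln (1 + alpha)) by (apply ln_increasing; lra); lra.
Qed.

Lemma lgap_1_le (alpha : R) (n : nat) : 0 < alpha -> lgap alpha 1 <= lgap alpha (S n).
Proof.
  intros Ha; unfold lgap; rewrite (S_INR n); assert (H0 := pos_INR n); simpl (INR 1).
  assert (ln (1 + alpha) <= ln (INR n + 1 + alpha)) by (apply ln_le; lra); lra.
Qed.

(** Equals [alpha / ((n + alpha) x_n^2)] for [n >= 1]. As [x_0 = 0], it is summed only from
    [n = 1]. *)
Definition weight (alpha : R) (n : nat) : R := exp (- lgap alpha n) / lgap alpha n ^ 2.

(** With [x < y] consecutive frequencies, [1 / (n + 2 + alpha) <= y - x] and [1 / y^2 <= 1 / (x y)],
    whose product is the telescoping [1 / x - 1 / y]. *)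
Lemma weight_le (alpha : R) (n : nat) : 0 < alpha ->
  weight alpha (S (S n)) <= alpha / lgap alpha (S n) - alpha / lgap alpha (S (S n)).
Proof.
  intros Ha; unfold weight; rewrite exp_opp_lgap by assumption.
  assert (H1 := lgap_1_pos alpha Ha).
  assert (H2 := lgap_1_le alpha n Ha).
  assert (H3 := lgap_1_le alpha (S n) Ha).
  assert (H0 := pos_INR n).
  assert (Hd : / (INR (S (S n)) + alpha) <= lgap alpha (S (S n)) - lgap alpha (S n)).
  { unfold lgap; rewrite !S_INR.
    assert (H := ln_succ_sub_ge (INR n + 1 + alpha) ltac:(lra)).
    replace (INR n + 1 + 1 + alpha) with (INR n + 1 + alpha + 1) by ring; lra. }
  assert (Hp : 0 < / (INR (S (S n)) + alpha)).
  { apply Rinv_0_lt_compat; rewrite !S_INR; lra. }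
  unfold Rdiv; set (v := / (INR (S (S n)) + alpha)) in *.
  set (x := lgap alpha (S n)) in *; set (y := lgap alpha (S (S n))) in *.
  replace (alpha * / x - alpha * / y) with (alpha * ((y - x) * / (x * y))) by (field; lra).
  rewrite Rmult_assoc; apply Rmult_le_compat_l; [lra|].
  apply Rmult_le_compat; [lra| |exact Hd|].
  - apply Rlt_le, Rinv_0_lt_compat, pow_lt; lra.
  - apply Rinv_le_contravar; nra.
Qed.

Lemma sum_weight_le (alpha : R) (N : nat) : 0 < alpha ->
  sum_n_m (weight alpha) 1 N <= weight alpha 1 + alpha / lgap alpha 1.
Proof.
  intros Ha.
  assert (H1 := lgap_1_pos alpha Ha).
  assert (Hq : forall n, 0 < alpha / lgap alpha (S n)).
  { intros n; apply Rdiv_lt_0_compat; [lra|].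
    assert (H2 := lgap_1_le alpha n Ha); lra. }
  assert (Hw : 0 < weight alpha 1).
  { apply Rdiv_lt_0_compat; [apply exp_pos|now apply pow_lt]. }
  destruct N as [|N].
  - rewrite sum_n_m_zero by lia; change (@zero _) with 0. assert (H := Hq O); lra.
  (* Keeping the last telescoping term makes the bound inductive. *)
  - apply Rle_trans with (weight alpha 1 + alpha / lgap alpha 1 - alpha / lgap alpha (S N));
      [|assert (H := Hq N); lra].
    induction N as [|N IH].
    + rewrite sum_n_n; lra.
    + rewrite sum_n_Sm by lia.
      assert (H := weight_le alpha N Ha).
      change (plus ?a ?b) with (a + b); lra.
Qed.

(** * Partial sums of the Dirichlet series integrated against the kernel *)

Lemma hurwitz_term_eq (alpha sigma tau : R) (n : nat) :
  hurwitz_term alpha (sigma, tau) n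
  = (exp (- sigma * ln (INR n + alpha)) * cis (- (tau * ln (INR n + alpha))))%C.
Proof.
  unfold hurwitz_term, RCpow, Cexp, cis.
  apply injective_projections; simpl.
  - rewrite !Rmult_0_r, Rminus_0_r, Rmult_0_l, Rminus_0_r. f_equal; f_equal; ring.
  - rewrite !Rmult_0_r, Rmult_0_l, Rplus_0_l, Rminus_0_r, Rplus_0_r; f_equal; f_equal; ring.
Qed.

(** The twist [cis (t * ln alpha)] lowers every frequency by [ln alpha], so that the term [n = 0] no
    longer depends on [t]. *)
Lemma hurwitz_term_split (alpha sigma T t : R) (n : nat) :
  (cis (t * ln alpha) * hurwitz_term alpha (sigma, (T + t)%R) n)%C
  = (exp (- sigma * ln (INR n + alpha)) * cis (- (T * ln (INR n + alpha)))
     * cis (- (lgap alpha n * t)))%C.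
Proof.
  rewrite hurwitz_term_eq.
  rewrite <- Cmult_assoc, <- cis_add, (Cmult_comm (cis _)), <- Cmult_assoc, <- cis_add.
  unfold lgap; do 2 f_equal; ring.
Qed.

Lemma Cmod_hurwitz_term (alpha sigma tau : R) (n : nat) :
  Cmod (hurwitz_term alpha (sigma, tau) n) = exp (- sigma * ln (INR n + alpha)).
Proof.
  rewrite hurwitz_term_eq, Cmod_mult, Cmod_cis, Cmod_R, Rmult_1_r.
  apply Rabs_pos_eq, Rlt_le, exp_pos.
Qed.

(** Term by term: [n = 0] yields the main term exactly, by [is_RInt_kernel], and each [n >= 1] adds
    an error bounded through [beta_prod_le] with [c = lgap alpha 1]. *)
Lemma mollified_partial_sum (alpha h r sigma T : R) (J N : nat) :
  0 < alpha -> 0 < r -> r * h = 2 * PI -> 1 <= sigma ->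
  exists V : C,
    is_RInt (V := C_R_NormedModule)
      (fun t => kernel r (S J) t * (cis (t * ln alpha) *
                  sum_n (hurwitz_term alpha (sigma, (T + t)%R)) N))%C 0 h V /\
    Cmod (V - h * (exp (- sigma * ln alpha) * cis (- (T * ln alpha))))
    <= exp (- sigma * ln alpha) *
       (2 * r * gap_prod (lgap alpha 1 / r) J * sum_n_m (weight alpha) 1 N).
Proof.
  intros Ha Hr Hh Hs; induction N as [|N (V & HV & HB)].
  - exists (h * (exp (- sigma * ln alpha) * cis (- (T * ln alpha))))%C; split.
    + assert (H := is_RInt_Cmult _ _ _ (exp (- sigma * ln alpha) * cis (- (T * ln alpha)))%C _
         (is_RInt_kernel h r (S J) Hr Hh)).
      rewrite Cmult_comm.
      eapply is_RInt_ext; [|exact H].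
      intros t _. rewrite sum_O, hurwitz_term_split.
      unfold lgap; simpl INR; rewrite Rplus_0_l, Rminus_diag, Rmult_0_l, Ropp_0, cis_0.
      match goal with |- ?x = ?y => change (@eq C x y) end; ring.
    + rewrite sum_n_m_zero by lia; change (@zero _) with 0.
      unfold Cminus; rewrite Cplus_opp_r, Cmod_0; lra.
  - set (x := lgap alpha (S N)).
    assert (H1 := lgap_1_pos alpha Ha).
    assert (H2 : lgap alpha 1 <= x) by (apply lgap_1_le; assumption).
    set (a := (exp (- sigma * ln (INR (S N) + alpha)) * cis (- (T * ln (INR (S N) + alpha))))%C).
    set (I := (- Ci * (1 - cis (- (x * h))) * beta_prod r (S J) x)%C).
    exists (V + a * I)%C; split.
    + assert (H := is_RInt_plus _ _ _ _ _ _ HV (is_RInt_Cmult _ _ _ a _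
         (is_RInt_kernel_cis h r x (S J) Hr Hh ltac:(lra)))).
      eapply is_RInt_ext; [|exact H].
      intros t _; rewrite sum_Sn.
      change (plus ?u ?v) with (u + v)%C.
      change (plus ?u ?v) with (u + v)%C.
      rewrite !Cmult_plus_distr_l, hurwitz_term_split; fold a x.
      match goal with |- ?x = ?y => change (@eq C x y) end; ring.
    + rewrite sum_n_Sm by lia; change (plus ?u ?v) with (u + v).
      replace (V + a * I - h * (exp (- sigma * ln alpha) * cis (- (T * ln alpha))))%C with
        (V - h * (exp (- sigma * ln alpha) * cis (- (T * ln alpha))) + a * I)%C by ring.
      eapply Rle_trans; [apply Cmod_triangle|].
      rewrite !Rmult_plus_distr_l; apply Rplus_le_compat; [exact HB|].
      destruct (beta_prod_le r (lgap alpha 1) x J Hr H1 H2) as [P0 P1].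
      assert (HI : Cmod I <= 2 * (r * gap_prod (lgap alpha 1 / r) J / x ^ 2)).
      { unfold I; rewrite !Cmod_mult, Cmod_opp, Cmod_Ci, Cmod_R, Rmult_1_l, Rabs_pos_eq by assumption.
        apply Rmult_le_compat; [apply Cmod_ge_0|assumption| |assumption].
        eapply Rle_trans; [apply Cmod_triangle|].
        rewrite Cmod_opp, Cmod_cis, Cmod_1; lra. }
      (* The modulus is [exp (- sigma * ln alpha) * exp (- sigma * x)]; [sigma >= 1] and [x > 0]
         remove [sigma] from the second factor. *)
      assert (Ha' : Cmod a <= exp (- sigma * ln alpha) * exp (- x)).
      { unfold a; rewrite Cmod_mult, Cmod_cis, Cmod_R, Rmult_1_r, Rabs_pos_eq
          by apply Rlt_le, exp_pos.
        rewrite <- exp_plus; apply Rnot_lt_le; intros Hlt; apply exp_lt_inv in Hlt.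
        revert Hlt; apply Rle_not_lt.
        replace (ln (INR (S N) + alpha)) with (x + ln alpha) by (unfold x, lgap; ring).
        nra. }
      rewrite Cmod_mult.
      eapply Rle_trans;
        [apply Rmult_le_compat; [apply Cmod_ge_0|apply Cmod_ge_0|exact Ha'|exact HI]|].
      right; unfold weight; fold x; field; lra.
Qed.

(** [J] is fixed before [sigma], [T] and [N], because the relative error of the main term is bounded
    independently of them. *)
Lemma partial_sum_bound (alpha h : R) : 0 < alpha -> 0 < h ->
  exists J : nat, forall (sigma T : R) (N : nat), 1 <= sigma ->
  exists (w : R -> C) (V : C),
    (forall t, Cmod (w t) <= 2 ^ J) /\
    is_RInt (V := C_R_NormedModule)
      (fun t => w t * sum_n (hurwitz_term alpha (sigma, (T + t)%R)) N)%C 0 h V /\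
    exp (- sigma * ln alpha) * (h / 2) <= Cmod V.
Proof.
  intros Ha Hh.
  assert (HPI := PI_RGT_0).
  assert (H1 := lgap_1_pos alpha Ha).
  set (r := 2 * PI / h).
  assert (Hr : 0 < r) by (apply Rdiv_lt_0_compat; lra).
  assert (Hrh : r * h = 2 * PI) by (unfold r; field; lra).
  set (W := weight alpha 1 + alpha / lgap alpha 1).
  assert (HW : 0 < W).
  { apply Rplus_lt_0_compat; apply Rdiv_lt_0_compat;
      [apply exp_pos|now apply pow_lt|lra|lra]. }
  assert (HrW : 0 < 4 * r * W) by nra.
  assert (Hc : 0 < lgap alpha 1 / r) by (apply Rdiv_lt_0_compat; lra).
  (* With this threshold the error [2 * r * gap_prod * W] is at most [h / 2], half of the main
     term. *)
  destruct (gap_prod_small (lgap alpha 1 / r) (h / (4 * r * W)) Hc) as [J HJ].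
  { apply Rdiv_lt_0_compat; lra. }
  exists (S J); intros sigma T N Hs.
  destruct (mollified_partial_sum alpha h r sigma T J N Ha Hr Hrh Hs) as (V & HV & HB).
  exists (fun t => kernel r (S J) t * cis (t * ln alpha))%C, V; repeat split.
  - intros t; rewrite Cmod_mult, Cmod_cis, Rmult_1_r; apply Cmod_kernel_le.
  - eapply is_RInt_ext; [|exact HV].
    intros t _; apply Cmult_assoc.
  - set (E := exp (- sigma * ln alpha)) in *.
    assert (HE : 0 < E) by apply exp_pos.
    assert (Hg := gap_prod_pos _ J Hc).
    assert (Hsum := sum_weight_le alpha N Ha); fold W in Hsum.
    assert (Hb : 2 * r * gap_prod (lgap alpha 1 / r) J * sum_n_m (weight alpha) 1 N <= h / 2).
    { apply Rle_trans with (2 * r * (h / (4 * r * W)) * W); [|right; field; lra].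
      apply Rle_trans with (2 * r * gap_prod (lgap alpha 1 / r) J * W).
      - apply Rmult_le_compat_l; [|assumption]. apply Rmult_le_pos; lra.
      - apply Rmult_le_compat_r; [lra|]. apply Rmult_le_compat_l; lra. }
    assert (Hm : Cmod (h * (E * cis (- (T * ln alpha)))) = E * h).
    { rewrite !Cmod_mult, Cmod_cis, !Cmod_R, !Rabs_pos_eq by lra; ring. }
    assert (Ht := Cmod_triangle (- (V - h * (E * cis (- (T * ln alpha))))) V).
    rewrite Cmod_opp in Ht.
    replace (- (V - h * (E * cis (- (T * ln alpha)))) + V)%C
      with (h * (E * cis (- (T * ln alpha))))%C in Ht by ring.
    rewrite Hm in Ht.
    assert (E * (2 * r * gap_prod (lgap alpha 1 / r) J * sum_n_m (weight alpha) 1 N)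
            <= E * (h / 2)) by (apply Rmult_le_compat_l; lra).
    lra.
Qed.

(** * From partial sums to [zeta], and from [sigma > 1] to the line [Re s = 1] *)

Lemma Cmod_minus_sym (x y : C) : Cmod (x - y) = Cmod (y - x).
Proof. rewrite <- Cmod_opp; f_equal; ring. Qed.

Lemma Rabs_Cmod_minus_le (x y : C) : Rabs (Cmod x - Cmod y) <= Cmod (x - y).
Proof.
  assert (H1 := Cmod_triangle (x - y) y).
  assert (H2 := Cmod_triangle (y - x) x).
  replace (x - y + y)%C with x in H1 by ring.
  replace (y - x + x)%C with y in H2 by ring.
  rewrite Cmod_minus_sym in H2; apply Rabs_le; lra.
Qed.

Lemma Cmod_le_plus (z : C) : Cmod z <= Rabs (fst z) + Rabs (snd z).
Proof.
  replace z with (fst z + Ci * snd z)%C at 1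
    by (destruct z; apply injective_projections; simpl; ring).
  eapply Rle_trans; [apply Cmod_triangle|].
  rewrite Cmod_mult, Cmod_Ci, !Cmod_R; lra.
Qed.

(** The moduli of the terms do not depend on [tau], so one Cauchy tail serves all [tau]. *)
Lemma partial_sum_unif (alpha : R) (zeta : C -> C) (sigma eps : R) :
  is_hurwitz_zeta alpha zeta -> 1 < sigma -> 0 < eps ->
  exists N : nat, forall tau : R,
    Cmod (sum_n (hurwitz_term alpha (sigma, tau)) N - zeta (sigma, tau)) <= eps.
Proof.
  intros [_ Hz] Hs He.
  set (a := fun n => exp (- sigma * ln (INR n + alpha))).
  (* At [tau = 0] the terms are the positive reals [a n], so the assumed convergence at [sigma] is
     already absolute. *)
  assert (Ha : ex_series a).
  { exists (fst (zeta (sigma, 0))).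
    assert (H := Hz (sigma, 0) Hs).
    unfold is_series in *.
    apply filterlim_locally; intros e.
    assert (H' := proj1 (filterlim_locally _ _) H e).
    revert H'; apply filter_imp; intros n [Hn _].
    assert (E : fst (sum_n (hurwitz_term alpha (sigma, 0)) n) = sum_n a n);
      [clear Hn|exact (eq_ind _ (ball (M := R_UniformSpace) _ e) Hn _ E)].
    assert (Hf : forall k, fst (hurwitz_term alpha (sigma, 0) k) = a k).
    { intros k; rewrite hurwitz_term_eq; unfold a, cis; simpl fst.
      rewrite Rmult_0_l, Ropp_0, cos_0, sin_0; ring. }
    induction n as [|n IH]; [rewrite !sum_O; apply Hf|].
    rewrite !sum_Sn, <- IH, <- Hf; reflexivity. }
  destruct (Cauchy_ex_series a Ha (mkposreal (eps / 2) ltac:(lra))) as [N HN].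
  exists N; intros tau.
  set (b := hurwitz_term alpha (sigma, tau)).
  assert (Hb := Hz (sigma, tau) Hs); fold b in Hb.
  assert (Hlim := proj1 (filterlim_locally_ball_norm _ _) Hb (mkposreal (eps / 2) ltac:(lra))).
  destruct Hlim as [M HM].
  specialize (HM (max M (S N)) (Nat.le_max_l _ _)).
  set (m := max M (S N)) in *.
  assert (Hm : (S N <= m)%nat) by apply Nat.le_max_r.
  change (Cmod (sum_n b m - zeta (sigma, tau)) < eps / 2) in HM.
  assert (Hd : Cmod (sum_n b m - sum_n b N) <= eps / 2).
  { apply Rle_trans with (norm (V := C_NormedModule) (sum_n_m b (S N) m)).
    { right; symmetry.
      exact (f_equal Cmod (sum_n_m_sum_n (G := C_NormedModule) b N m ltac:(lia))). }
    eapply Rle_trans; [apply (norm_sum_n_m (V := C_NormedModule))|].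
    apply Rlt_le, Rle_lt_trans with (2 := HN (S N) m ltac:(lia) ltac:(lia)).
    rewrite (sum_n_m_ext _ a); [apply Rle_abs|].
    intros n; apply Cmod_hurwitz_term. }
  replace (sum_n b N - zeta (sigma, tau))%C with
    (- (sum_n b m - sum_n b N) + (sum_n b m - zeta (sigma, tau)))%C by ring.
  eapply Rle_trans; [apply Cmod_triangle|].
  rewrite Cmod_opp; lra.
Qed.

Lemma zeta_continuous (alpha : R) (zeta : C -> C) (s : C) (eps : R) :
  is_hurwitz_zeta alpha zeta -> s <> 1%C -> 0 < eps ->
  exists d : posreal, forall z : C, Cmod (z - s) < d -> Cmod (zeta z - zeta s) < eps.
Proof.
  intros [Hz _] Hs He.
  assert (H := ex_derive_continuous _ _ (Hz s Hs)).
  destruct (proj1 (filterlim_locally_ball_norm _ _) H (mkposreal eps He)) as [d Hd].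
  exists d; intros z Hzs; apply (Hd z); exact Hzs.
Qed.

Lemma zeta_continuity_2d (alpha : R) (zeta : C -> C) (x y : R) :
  is_hurwitz_zeta alpha zeta -> 0 < y ->
  continuity_2d_pt (fun u v => fst (zeta (u, v))) x y /\
  continuity_2d_pt (fun u v => snd (zeta (u, v))) x y.
Proof.
  intros Hz Hy.
  assert (Hs : (x, y) <> RtoC 1) by (intros E; apply (f_equal snd) in E; simpl in E; lra).
  assert (H : forall eps : posreal,
    locally_2d (fun u v => Cmod (zeta (u, v) - zeta (x, y)) < eps) x y).
  { intros eps.
    destruct (zeta_continuous alpha zeta (x, y) eps Hz Hs (cond_pos eps)) as [d Hd].
    exists (pos_div_2 d); intros u v Hu Hv; apply Hd.
    eapply Rle_lt_trans; [apply Cmod_le_plus|]; simpl in *.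
    change (Rabs (u - x) + Rabs (v - y) < d); lra. }
  split; intros eps; destruct (H eps) as [d Hd]; exists d; intros u v Hu Hv;
    (eapply Rle_lt_trans; [|apply (Hd u v Hu Hv)]);
    (eapply Rle_trans; [|apply Rmax_Cmod]); [apply Rmax_l|apply Rmax_r].
Qed.

(** Uniform continuity of both components on the compact rectangle [[1, 2] x [T, T + h]], which
    misses the pole because [T > 0]. *)
Lemma zeta_near_line (alpha : R) (zeta : C -> C) (T h eps : R) :
  is_hurwitz_zeta alpha zeta -> 0 < T -> 0 < eps ->
  exists sigma : R, 1 < sigma <= 2 /\
    forall tau, T <= tau <= T + h -> Cmod (zeta (sigma, tau) - zeta (1, tau)) <= eps.
Proof.
  intros Hz HT He.
  assert (He2 : 0 < eps / 2) by lra.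
  destruct (uniform_continuity_2d (fun u v => fst (zeta (u, v))) 1 2 T (T + h)) with
    (eps := mkposreal _ He2) as [d1 H1].
  { intros x y _ Hy; apply (zeta_continuity_2d alpha zeta x y Hz); lra. }
  destruct (uniform_continuity_2d (fun u v => snd (zeta (u, v))) 1 2 T (T + h)) with
    (eps := mkposreal _ He2) as [d2 H2].
  { intros x y _ Hy; apply (zeta_continuity_2d alpha zeta x y Hz); lra. }
  assert (Hd1 := cond_pos d1); assert (Hd2 := cond_pos d2).
  set (m := Rmin 1 (Rmin d1 d2)).
  assert (Hm : 0 < m) by (unfold m; repeat apply Rmin_glb_lt; lra).
  assert (Hm1 : m <= 1) by apply Rmin_l.
  assert (Hm2 : m <= Rmin d1 d2) by apply Rmin_r.
  assert (Rmin d1 d2 <= d1) by apply Rmin_l.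
  assert (Rmin d1 d2 <= d2) by apply Rmin_r.
  exists (1 + m / 2); split; [lra|]; intros tau Ht.
  assert (Hx : Rabs (1 + m / 2 - 1) = m / 2).
  { replace (1 + m / 2 - 1) with (m / 2) by ring; apply Rabs_pos_eq; lra. }
  assert (Hy : Rabs (tau - tau) = 0) by (rewrite Rminus_diag; apply Rabs_R0).
  eapply Rle_trans; [apply Cmod_le_plus|].
  specialize (H1 1 tau (1 + m / 2) tau); specialize (H2 1 tau (1 + m / 2) tau).
  rewrite Hx, Hy in H1, H2; simpl in *.
  unfold Rminus in H1, H2.
  assert (H1' := H1 ltac:(lra) Ht ltac:(lra) Ht ltac:(lra) ltac:(lra)).
  assert (H2' := H2 ltac:(lra) Ht ltac:(lra) Ht ltac:(lra) ltac:(lra)).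
  lra.
Qed.

Lemma zeta_line_integrable (alpha : R) (zeta : C -> C) (a b : R) :
  is_hurwitz_zeta alpha zeta -> 0 < a <= b ->
  ex_RInt (fun t => Cmod (zeta (1, t))) a b.
Proof.
  intros Hz Hab; apply (ex_RInt_continuous (V := R_CompleteNormedModule)).
  rewrite Rmin_left, Rmax_right by lra; intros t Ht.
  apply filterlim_locally; intros eps.
  assert (Hs : (1, t) <> RtoC 1)
    by (intros E; apply (f_equal snd) in E; simpl in E; lra).
  destruct (zeta_continuous alpha zeta (1, t) eps Hz Hs (cond_pos eps)) as [d Hd].
  exists d; intros y Hy.
  eapply Rle_lt_trans; [apply Rabs_Cmod_minus_le|apply Hd].
  eapply Rle_lt_trans; [apply Cmod_le_plus|].
  simpl; rewrite Rplus_opp_r, Rabs_R0, Rplus_0_l; exact Hy.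
Qed.

Theorem corollary3 :
  forall (alpha : R), 0 < alpha ->
  forall (zeta : C -> C), is_hurwitz_zeta alpha zeta ->
  forall delta : R, 0 < delta ->
  exists C_delta : R, 0 < C_delta /\
    forall T : R, 2 <= T ->
      C_delta <= RInt (fun t : R => Cmod (zeta (1 + Ci * t)%C)) T (T + delta).
Proof.
  intros alpha Ha zeta Hz h Hh.
  destruct (partial_sum_bound alpha h Ha Hh) as [J HJ].
  (* Lower bound for [exp (- sigma * ln alpha) * (h / 2)] valid for all [1 < sigma <= 2], whatever
     the sign of [ln alpha]. *)
  set (c := exp (- 2 * Rabs (ln alpha)) * (h / 2)).
  assert (Hc : 0 < c) by (apply Rmult_lt_0_compat; [apply exp_pos|lra]).
  assert (H2 : 0 < 2 ^ J) by (apply pow_lt; lra).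
  exists (c / 2 ^ J / 2); split.
  { assert (0 < c / 2 ^ J) by now apply Rdiv_lt_0_compat. lra. }
  intros T HT.
  rewrite (RInt_ext _ (fun t => Cmod (zeta (1, t)))).
  2:{ intros t _; do 2 f_equal; apply injective_projections; simpl; ring. }
  assert (Hex := zeta_line_integrable alpha zeta T (T + h) Hz ltac:(lra)).
  (* Chosen so that [h * e] is half of [c / 2 ^ J]; the other half is the final constant. *)
  set (e := c / 2 ^ J / 2 / h).
  assert (He : 0 < e).
  { apply Rdiv_lt_0_compat; [|lra].
    assert (0 < c / 2 ^ J) by now apply Rdiv_lt_0_compat. lra. }
  (* [sigma] and [N] may depend on [T]: neither enters [J] or [c]. *)
  destruct (zeta_near_line alpha zeta T h (e / 2) Hz ltac:(lra) ltac:(lra)) as (sigma & Hs & Hn).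
  destruct (partial_sum_unif alpha zeta sigma (e / 2) Hz ltac:(lra) ltac:(lra)) as [N HN].
  destruct (HJ sigma T N ltac:(lra)) as (w & V & Hw & HV & HB).
  set (I := RInt (fun t => Cmod (zeta (1, t))) T (T + h)).
  assert (HI : is_RInt (fun t => Cmod (zeta (1, (T + t)%R))) 0 h I).
  { assert (H := RInt_correct _ _ _ Hex); fold I in H.
    replace (T + h) with (1 * h + T) in H by ring.
    replace T with (1 * 0 + T) in H at 1 by ring.
    apply is_RInt_comp_lin in H.
    eapply is_RInt_ext; [|exact H].
    intros t _; simpl; change (scal ?u ?v) with (u * v).
    rewrite !Rmult_1_l, (Rplus_comm t T); reflexivity. }
  assert (HG : is_RInt (fun t => 2 ^ J * (Cmod (zeta (1, (T + t)%R)) + e)) 0 h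
                 (2 ^ J * (I + (h - 0) * e))).
  { apply (is_RInt_scal (V := R_NormedModule)), (is_RInt_plus (V := R_NormedModule)); [exact HI|].
    apply (is_RInt_const (V := R_NormedModule)). }
  (* The kernel costs at most [2 ^ J], and replacing the partial sum at [sigma] by [zeta] on the
     line costs at most [e / 2 + e / 2]. *)
  assert (HV' : Cmod V <= 2 ^ J * (I + (h - 0) * e)).
  { rewrite <- norm_C_R.
    refine (norm_RInt_le _ _ 0 h _ _ (Rlt_le _ _ Hh) _ HV HG).
    intros t Ht; rewrite norm_C_R, Cmod_mult.
    apply Rmult_le_compat; [apply Cmod_ge_0|apply Cmod_ge_0|apply Hw|].
    specialize (HN (T + t)); specialize (Hn (T + t) ltac:(lra)).
    set (S := sum_n _ N : C) in *.
    replace (S : C) with (zeta (1, (T + t)%R) + ((S - zeta (sigma, (T + t)%R))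
      + (zeta (sigma, (T + t)%R) - zeta (1, (T + t)%R))))%C by ring.
    eapply Rle_trans; [apply Cmod_triangle|].
    apply Rplus_le_compat_l.
    eapply Rle_trans; [apply Cmod_triangle|]. lra. }
  assert (Hc' : c <= exp (- sigma * ln alpha) * (h / 2)).
  { apply Rmult_le_compat_r; [lra|].
    apply Rnot_lt_le; intros Hlt; apply exp_lt_inv in Hlt.
    assert (Hl := Rle_abs (ln alpha)). assert (Hp := Rabs_pos (ln alpha)). nra. }
  assert (Hce : c / 2 ^ J <= I + (h - 0) * e).
  { apply (Rmult_le_reg_l (2 ^ J)); [assumption|].
    replace (2 ^ J * (c / 2 ^ J)) with c by (field; lra). lra. }
  assert (h * e = c / 2 ^ J / 2) by (unfold e; field; lra).
  lra.
Qed.
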